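(* Let $E\subset\mathbb{R}^n$ be such that there are points $x_0, x_1, \ldots, x_n\in E$ so that $\{x_1-x_0, \ldots, x_n-x_0\}$ is a basis of $\mathbb{R}^n$. Let $f:E\to\mathbb{R}$, $G:E\to\mathbb{R}^n$ be arbitrary functions. Then there exists a function $F\in C^{1,1}_{\mathrm{loc}}(\mathbb{R}^n)$ such that $F_{|_E}=f$, $(\nabla F)_{|_E}=G$ if and only if there exist a convex function $\psi\in C^{1,1}_{\mathrm{loc}}(\mathbb{R}^n)$ and, for $y\in E$, functions $\varphi_{y}:\mathbb{R}^n\to [0, \infty)$ of class $C^{1,1}_{\mathrm{loc}}$ such that: $$\mathrm{span}\{G(y)+\nabla\psi(y)-G(z)-\nabla\psi(z) : y, z\in E\}=\mathbb{R}^n;$$ $$\varphi_{y}(y)=0,\quad \nabla\varphi_{y}(y)=0\quad\text{for every } y\in E;$$ $$\sup\left\{\frac{|\nabla\varphi_{y}(x)-\nabla\varphi_{y}(z)|}{|x-z|} \, : x, z\in B(0, R),\ x\neq z, \ y\in E\cap B(0,R)\right\} <\infty$$ for every $R>0$, and $$f(z)+\psi(z)+ \langle G(z)+\nabla\psi(z), x-z\rangle\leq f(y)+\psi(y)+\langle G(y)+\nabla\psi(y), x-y\rangle +\varphi_{y}(x)$$ for every $y, z\in E$ and every $x\in \mathbb{R}^n$. Moreover, whenever these conditions are satisfied, for every number $a>0$ the formula $$F=\mathrm{conv}\left(x\mapsto \inf_{y\in E}\left\{f(y)+\psi(y)+\langle G(y) +\nabla\psi(y), x-y\rangle+\varphi_{y}(x)+a|x-y|^2\right\}\right)-\psi$$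 defines a $C^{1,1}_{\mathrm{loc}}$ extension of the jet $(f, G)$ to $\mathbb{R}^n$ (that is, $F\in C^{1,1}_{\mathrm{loc}}(\mathbb{R}^n)$, $F=f$ and $\nabla F=G$ on $E$).
   Context: $|\cdot|$, $\langle\cdot,\cdot\rangle$ are the Euclidean norm and inner product, and $B(x,r)$ is the closed ball of center $x$ and radius $r$. $C^{1,1}_{\mathrm{loc}}(\mathbb{R}^n)$ is the class of differentiable functions whose gradient is Lipschitz on every ball. A supremum over the empty set of nonnegative quantities is $0$. $\mathrm{conv}(g)(x)=\sup\{\varphi(x) : \varphi \text{ convex}, \varphi\leq g\}$ is the convex envelope of $g:\mathbb{R}^n\to\mathbb{R}$. *)

(* Defs.v *)
From HB Require Import structures.
From mathcomp Require Import all_boot all_order all_algebra.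
From mathcomp Require Import all_classical all_reals all_analysis.

Set Implicit Arguments.
Unset Strict Implicit.
Unset Printing Implicit Defensive.

Import Order.TTheory GRing.Theory Num.Theory.
Import numFieldNormedType.Exports.

Local Open Scope classical_set_scope.
Local Open Scope ring_scope.

(* The canonical norm on 'rV[R]_n is the sup norm, so the Euclidean structure
   is introduced explicitly. Both norms give the same topology, hence the same
   [differentiable]. *)
Definition dotp (R : realType) (n : nat) (u v : 'rV[R]_n) : R :=
  \sum_(i < n) u 0 i * v 0 i.

Definition enorm (R : realType) (n : nat) (u : 'rV[R]_n) : R :=
  Num.sqrt (dotp u u).

Definition eball (R : realType) (n : nat) (c : 'rV[R]_n) (r : R)
  : set 'rV[R]_n := [set x | enorm (x - c) <= r].

(* Only meaningful where F is differentiable. *)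
Definition grad (R : realType) (n : nat) (F : 'rV[R]_n -> R) (x : 'rV[R]_n)
  : 'rV[R]_n := \row_(i < n) 'D_(delta_mx 0 i) F x.

Definition C11loc (R : realType) (n : nat) (F : 'rV[R]_n -> R) : Prop :=
  (forall x, differentiable F x) /\
  (forall (c : 'rV[R]_n) (r : R), exists L : R,
     forall x y, eball c r x -> eball c r y ->
       enorm (grad F x - grad F y) <= L * enorm (x - y)).

Definition lin_span (R : realType) (n : nat) (S : set 'rV[R]_n)
  : set 'rV[R]_n :=
  [set v | exists (m : nat) (c : 'I_m -> R) (w : 'I_m -> 'rV[R]_n),
     (forall i, S (w i)) /\ v = \sum_(i < m) c i *: w i].

(* [sup] is 0 on sets that are empty or unbounded above; the set below is
   bounded above by g x, and nonempty as soon as g has a convex minorant. *)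
Definition conv_env (R : realType) (n : nat) (g : 'rV[R]_n -> R)
  (x : 'rV[R]_n) : R :=
  sup [set t : R | exists h : 'rV[R]_n -> R,
     [/\ convex_function setT h, forall u, h u <= g u & t = h x]].

(* Functions on E are total functions whose values outside E are never used. *)
Definition extends_jet (R : realType) (n : nat) (E : set 'rV[R]_n)
  (f : 'rV[R]_n -> R) (G : 'rV[R]_n -> 'rV[R]_n) (F : 'rV[R]_n -> R) : Prop :=
  [/\ C11loc F,
      forall y, E y -> F y = f y
    & forall y, E y -> grad F y = G y].

Definition jet_conditions (R : realType) (n : nat) (E : set 'rV[R]_n)
  (f : 'rV[R]_n -> R) (G : 'rV[R]_n -> 'rV[R]_n)
  (psi : 'rV[R]_n -> R) (phi : 'rV[R]_n -> 'rV[R]_n -> R) : Prop :=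
  (convex_function setT psi /\ C11loc psi) /\
  (forall y, E y -> C11loc (phi y) /\ forall x, 0 <= phi y x) /\
  lin_span [set G y + grad psi y - G z - grad psi z | y in E & z in E]
    = setT /\
  (forall y, E y -> phi y y = 0 /\ grad (phi y) y = 0) /\
  (forall r : R, 0 < r ->
     (ereal_sup [set q : \bar R | exists x z y,
        [/\ eball 0 r x, eball 0 r z, x != z, (E `&` eball 0 r) y
          & q = (enorm (grad (phi y) x - grad (phi y) z)
                 / enorm (x - z))%:E]] < +oo)%E) /\
  (forall y z x, E y -> E z ->
     f z + psi z + dotp (G z + grad psi z) (x - z)
       <= f y + psi y + dotp (G y + grad psi y) (x - y) + phi y x).

(* The real-valued [inf] carries no junk value where this is used: for E
   nonempty, the last clause of [jet_conditions] bounds the set from below, by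
   an affine function of x (fix z in E there). *)
Definition jet_inf (R : realType) (n : nat) (E : set 'rV[R]_n)
  (f : 'rV[R]_n -> R) (G : 'rV[R]_n -> 'rV[R]_n)
  (psi : 'rV[R]_n -> R) (phi : 'rV[R]_n -> 'rV[R]_n -> R) (a : R)
  (x : 'rV[R]_n) : R :=
  inf [set f y + psi y + dotp (G y + grad psi y) (x - y) + phi y x
           + a * enorm (x - y) ^+ 2 | y in E].

(* Main.v *)
(* Only quadratic Taylor bounds are used: F is C^{1,1}_loc with gradient g iff
   |F y - F x - <g x, y - x>| <= C |y - x|^2 locally uniformly in x and y.

   Necessity: take psi x = th (|x|^2) + k |x|^2 with th convex and growing so
   fast that psi beats the Taylor constant of F on every ball. Then H = F + psi
   is convex, phi_y is the remainder of H at y, and all but finitely many k make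
   the differences of grad H at the points of the affine basis independent.

   Sufficiency: let m be the infimum and H its convex envelope. The tangents at
   E are minorants of m, so H agrees with the jet on E; by the spanning condition
   H minus some affine function grows at least like c|x|; and m is locally
   semiconcave, since far away y do not compete in the infimum. Let p0, p1 be
   affine functions supporting H at x0, x1 in a ball, with slopes g0, g1.
   Semiconcavity gives m >= (p0 + p1)/2 + const |g1 - g0|^2 on a larger ball.
   Outside that ball m dominates some convex kap which exceeds H + 1 on the small
   ball, so the convex function (1 - t)(p0 + p1)/2 + t kap is a minorant of m for
   t of order |g1 - g0|^2. Hence H >= (p0 + p1)/2 + t at x0 and x1, and adding
   the two inequalities gives 4 t <= <g1 - g0, x1 - x0>, that is, subgradients
   are locally Lipschitz. *)
Require Import Defs.
From HB Require Import structures.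
From mathcomp Require Import all_boot all_order all_algebra.
From mathcomp Require Import all_classical all_reals all_analysis.
From mathcomp Require Import ring lra.

Import Order.TTheory GRing.Theory Num.Theory.
Import numFieldNormedType.Exports.

Local Open Scope classical_set_scope.
Local Open Scope ring_scope.

(** * Euclidean structure *)

Section Euclidean.
Context {R : realType} {n : nat}.
Implicit Types (u v w x y : 'rV[R]_n) (c t r : R).

Lemma dotpC u v : dotp u v = dotp v u.
Proof. by apply: eq_bigr => i _; rewrite mulrC. Qed.

Lemma dotpDl u v w : dotp (u + v) w = dotp u w + dotp v w.
Proof. by rewrite /dotp -big_split /=; apply: eq_bigr => i _; rewrite mxE mulrDl. Qed.

Lemma dotpZl c u v : dotp (c *: u) v = c * dotp u v.
Proof. by rewrite /dotp mulr_sumr; apply: eq_bigr => i _; rewrite mxE mulrA. Qed.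

Lemma dotpNl u v : dotp (- u) v = - dotp u v.
Proof. by rewrite -scaleN1r dotpZl mulN1r. Qed.

Lemma dotpBl u v w : dotp (u - v) w = dotp u w - dotp v w.
Proof. by rewrite dotpDl dotpNl. Qed.

Lemma dotp0l u : dotp 0 u = 0.
Proof. by rewrite -(scale0r 0) dotpZl mul0r. Qed.

Lemma dotpDr u v w : dotp u (v + w) = dotp u v + dotp u w.
Proof. by rewrite dotpC dotpDl !(dotpC u). Qed.

Lemma dotpZr c u v : dotp u (c *: v) = c * dotp u v.
Proof. by rewrite dotpC dotpZl (dotpC u). Qed.

Lemma dotpNr u v : dotp u (- v) = - dotp u v.
Proof. by rewrite dotpC dotpNl (dotpC u). Qed.

Lemma dotpBr u v w : dotp u (v - w) = dotp u v - dotp u w.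
Proof. by rewrite dotpDr dotpNr. Qed.

Lemma dotp0r u : dotp u 0 = 0.
Proof. by rewrite dotpC dotp0l. Qed.

Definition dotpE :=
  (dotpDl, dotpDr, dotpNl, dotpNr, dotpZl, dotpZr, dotp0l, dotp0r).

Lemma dotp_ge0 u : 0 <= dotp u u.
Proof. by apply: sumr_ge0 => i _; rewrite -expr2 sqr_ge0. Qed.

Lemma dotp_eq0 u : dotp u u = 0 -> u = 0.
Proof.
move=> /eqP; rewrite psumr_eq0; last by move=> i _; rewrite -expr2 sqr_ge0.
move=> /allP u0; apply/rowP => i; rewrite mxE.
have := u0 i (mem_index_enum i); rewrite /= mulf_eq0 orbb; exact/eqP.
Qed.

Lemma dotp_delta u i : dotp u (delta_mx 0 i) = u 0 i.
Proof.
rewrite /dotp (bigD1 i) //= mxE !eqxx mulr1 big1 ?addr0 // => j /negbTE ji.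
by rewrite mxE ji andbF mulr0.
Qed.

Lemma enorm_ge0 u : 0 <= enorm u.
Proof. exact: sqrtr_ge0. Qed.
Hint Resolve enorm_ge0 : core.

Lemma enorm_sqr u : enorm u ^+ 2 = dotp u u.
Proof. by rewrite sqr_sqrtr // dotp_ge0. Qed.

Lemma enormZ c u : enorm (c *: u) = `|c| * enorm u.
Proof.
by rewrite /enorm !dotpE mulrA -expr2 sqrtrM ?sqr_ge0 // sqrtr_sqr.
Qed.

Lemma enorm0 : enorm (0 : 'rV[R]_n) = 0.
Proof. by rewrite /enorm dotp0l sqrtr0. Qed.

Lemma enormN u : enorm (- u) = enorm u.
Proof. by rewrite -scaleN1r enormZ normrN1 mul1r. Qed.

Lemma enormB u v : enorm (u - v) = enorm (v - u).
Proof. by rewrite -enormN opprB. Qed.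

Lemma enorm_eq0 u : enorm u = 0 -> u = 0.
Proof. by move=> u0; apply: dotp_eq0; rewrite -enorm_sqr u0 expr0n. Qed.

Lemma dotp_le u v : dotp u v <= enorm u * enorm v.
Proof.
have [->|u0] := eqVneq u 0; first by rewrite dotp0l enorm0 mul0r.
have [->|v0] := eqVneq v 0; first by rewrite dotp0r enorm0 mulr0.
have up : 0 < enorm u.
  by rewrite lt_neqAle enorm_ge0 andbT eq_sym; apply: contra u0 => /eqP/enorm_eq0/eqP.
have vp : 0 < enorm v.
  by rewrite lt_neqAle enorm_ge0 andbT eq_sym; apply: contra v0 => /eqP/enorm_eq0/eqP.
have := dotp_ge0 (enorm v *: u - enorm u *: v).
rewrite !dotpE -!enorm_sqr (dotpC v u) => h.
have : 0 <= (enorm u * enorm v) * (enorm u * enorm v - dotp u v) by nra.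
by rewrite pmulr_rge0 ?subr_ge0 // mulr_gt0.
Qed.

Lemma normr_dotp_le u v : `|dotp u v| <= enorm u * enorm v.
Proof. by rewrite ler_norml lerNl -dotpNl -{1}(enormN u) !dotp_le. Qed.

Lemma enormD_le u v : enorm (u + v) <= enorm u + enorm v.
Proof.
rewrite -(@ler_pXn2r _ 2) ?nnegrE ?addr_ge0 //.
rewrite enorm_sqr !dotpE -!enorm_sqr (dotpC v u).
have := dotp_le u v; lra.
Qed.

Lemma enormB_le u v : enorm (u - v) <= enorm u + enorm v.
Proof. by rewrite (le_trans (enormD_le _ _)) // enormN. Qed.

Lemma enorm_leD u v : enorm u <= enorm v + enorm (u - v).
Proof. by rewrite -{1}(subrK v u) addrC (le_trans (enormD_le _ _)). Qed.

Lemma enorm_convex x y t : 0 <= t -> t <= 1 ->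
  enorm (t *: x + (1 - t) *: y) <= t * enorm x + (1 - t) * enorm y.
Proof.
move=> t0 t1; rewrite (le_trans (enormD_le _ _)) // !enormZ !ger0_norm //.
by rewrite subr_ge0.
Qed.

Lemma enorm_delta i : enorm (delta_mx 0 i : 'rV[R]_n) = 1.
Proof. by rewrite /enorm dotp_delta mxE !eqxx sqrtr1. Qed.

Lemma enorm_le_sum u : enorm u <= \sum_(i < n) `|u 0 i|.
Proof.
rewrite {1}(row_sum_delta u).
elim/big_ind2 : _ => [|a b c d ab cd|i _]; first by rewrite enorm0.
  by rewrite (le_trans (enormD_le _ _)) // lerD.
by rewrite enormZ enorm_delta mulr1.
Qed.

Lemma enorm_le_norm u : enorm u <= n%:R * `|u|.
Proof.
rewrite (le_trans (enorm_le_sum u)) //.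
have -> : n%:R * `|u| = \sum_(i < n) `|u| by rewrite sumr_const card_ord mulr_natl.
apply: ler_sum => i _; rewrite [`|u|]mx_normrE.
exact: (le_bigmax _ (fun k => `|u k.1 k.2|) (0, i)).
Qed.

End Euclidean.

#[local] Hint Extern 0 (is_true (_ <= enorm _)) => solve [exact: enorm_ge0] : core.

(** * Quadratic Taylor bounds *)

Lemma differentiable_of_bound {K : numFieldType} {V W : normedModType K}
    (f : V -> W) (df : {linear V -> W}) x :
  continuous df ->
  (forall e : K, 0 < e ->
     \forall h \near (0 : V), `|f (h + x) - (f x + df h)| <= e * `|h|) ->
  differentiable f x /\ 'd f x = df :> (V -> W).
Proof.
move=> dfc H.
have Ho : f \o shift x = cst (f x) + df +o_ 0 id.
  by apply/eqaddoP => e e0; exact: H.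
have E := diff_unique dfc Ho; split=> //.
by apply/diff_locallyP; rewrite E; split.
Qed.

Section Quadratic.
Context {R : realType} {n : nat}.
Implicit Types (u v w x y z : 'rV[R]_n) (F : 'rV[R]_n -> R)
  (g : 'rV[R]_n -> 'rV[R]_n) (c t r C L : R).

(** Here [N] stands for the sup norm and [d] for the Euclidean norm of one vector: near 0 a
    quadratic Euclidean error falls below any linear sup-norm error, which is what differentiability
    asks for. *)
Lemma quadratic_le_linear C (m e N d : R) :
  0 <= m -> 0 < e -> 0 <= N -> 0 <= d -> d <= m * N ->
  (m + `|C| * m ^+ 2 / e + 1) * N <= 1 -> d <= 1 /\ C * d ^+ 2 <= e * N.
Proof.
move=> m0 e0 N0 d0 dN k.
have C0 : 0 <= `|C| * m ^+ 2 / e by rewrite divr_ge0 ?mulr_ge0 ?sqr_ge0 // ltW.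
split; first by nra.
apply: (@le_trans _ _ (`|C| * (m * N) ^+ 2)).
  rewrite (@le_trans _ _ (`|C| * d ^+ 2)) //.
    by rewrite ler_wpM2r ?sqr_ge0 // ler_norm.
  by rewrite ler_wpM2l // ler_pXn2r ?nnegrE ?mulr_ge0.
have -> : `|C| * (m * N) ^+ 2 = e * N * (`|C| * m ^+ 2 / e * N).
  by field; rewrite gt_eqF.
rewrite -[leRHS]mulr1 ler_wpM2l ?mulr_ge0 // ?(ltW e0) //; nra.
Qed.

Lemma dotp_is_linear (a : 'rV[R]_n) : linear (dotp a : 'rV[R]_n -> R).
Proof. by move=> c u v; rewrite dotpDr dotpZr. Qed.

HB.instance Definition _ (a : 'rV[R]_n) :=
  GRing.isLinear.Build R _ _ _ (dotp a : 'rV[R]_n -> R) (dotp_is_linear a).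

Lemma dotp_continuous (a : 'rV[R]_n) : continuous (dotp a : 'rV[R]_n -> R).
Proof.
have bd (x : 'rV[R]_n) : `|x| <= 1 -> `|dotp a x| <= enorm a * n%:R.
  move=> x1; rewrite (le_trans (normr_dotp_le _ _)) // ler_wpM2l //.
  by rewrite (le_trans (enorm_le_norm x)) // -[leRHS]mulr1 ler_wpM2l.
apply/linear_bounded_continuous; rewrite /bounded_near; near=> M.
near=> x; apply: (@le_trans _ _ (enorm a * n%:R)).
  by apply: bd; near: x; exact: (@nbhs0_le R 'rV[R]_n 1 ltr01).
by near: M; apply: nbhs_pinfty_ge; rewrite num_real.
Unshelve. all: by end_near. Qed.

Lemma differentiable_quad F x (a : 'rV[R]_n) C :
  (forall y, enorm (y - x) <= 1 ->
     `|F y - F x - dotp a (y - x)| <= C * enorm (y - x) ^+ 2) ->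
  differentiable F x /\ grad F x = a.
Proof.
move=> H.
pose df : {linear 'rV[R]_n -> R} := dotp a.
have dfc : continuous df := dotp_continuous a.
have [|d E] := differentiable_of_bound (F : 'rV[R]_n -> R) df x dfc.
  move=> e e0.
  pose K : R := n%:R + `|C| * n%:R ^+ 2 / e + 1.
  have K0 : 0 < K.
    by rewrite ltr_wpDl // addr_ge0 // divr_ge0 ?mulr_ge0 ?sqr_ge0 // ltW.
  have bd (h : 'rV[R]_n) : `|h| <= K^-1 ->
      `|F (h + x) - (F x + dotp a h)| <= e * `|h|.
    move=> k1; rewrite opprD addrA.
    have [||||||h1 /(le_trans _)] := @quadratic_le_linear C n%:R e `|h| (enorm h) => //.
    - exact: enorm_le_norm.
    - by rewrite mulrC -ler_pdivlMr // div1r.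
    apply; have := H (h + x); rewrite addrK; exact.
  near=> h; apply: bd; near: h; apply: (@nbhs0_le R 'rV[R]_n).
  by rewrite invr_gt0.
split=> //; apply/rowP => i; rewrite mxE deriveE // E.
exact: dotp_delta.
Unshelve. all: by end_near. Qed.

Lemma derive_dotp_grad F x v : differentiable F x -> 'D_v F x = dotp (grad F x) v.
Proof.
move=> d; rewrite deriveE // {1}(row_sum_delta v) linear_sum; apply: eq_bigr => i _.
by rewrite linearZ mxE deriveE // mulrC.
Qed.

Lemma is_derive_line F x v t : (forall x, differentiable F x) ->
  is_derive t 1 (fun s => F (x + s *: v)) (dotp (grad F (x + t *: v)) v).
Proof.
move=> d; rewrite -derive_dotp_grad //.
have /derivableP [] := @diff_derivable _ _ _ F _ v (d (x + t *: v)).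
rewrite /derivable /derive => df _.
have E : (fun h => h^-1 *: (((fun s => F (x + s *: v)) \o shift t) (h *: 1)
    - F (x + t *: v))) = (fun h => h^-1 *: ((F \o shift (x + t *: v)) (h *: v)
    - F (x + t *: v))).
  apply/funext => h /=; do 2 f_equal.
  by rewrite [h%:A]mulr1 scalerDl addrCA.
by split; rewrite /derivable /derive E.
Qed.

Lemma grad_mean_value F x y : (forall x, differentiable F x) ->
  exists t, [/\ 0 <= t, t <= 1 &
    F y - F x = dotp (grad F (x + t *: (y - x))) (y - x)].
Proof.
move=> d; pose f s := F (x + s *: (y - x)).
have df t : is_derive t 1 f (dotp (grad F (x + t *: (y - x))) (y - x)).
  exact: is_derive_line.
have [|c /itvP c01 ] := MVT_segment ler01 (fun t _ => df t).
  apply: derivable_within_continuous => t _; exact: ex_derive.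
rewrite /f scale1r scale0r addr0 subr0 mulr1 addrC [x + (y - x)]addrC subrK [- _ + _]addrC => E.
by exists c; rewrite !c01.
Qed.

(** By the mean value theorem the remainder is [dotp (grad F z - grad F x) (y - x)] for some [z] on
    the segment, which stays in the ball by convexity. *)
Lemma lipschitz_grad_quad F L r : (forall x, differentiable F x) ->
  (forall x y, enorm x <= r -> enorm y <= r ->
     enorm (grad F x - grad F y) <= L * enorm (x - y)) ->
  forall x y, enorm x <= r -> enorm y <= r ->
    `|F y - F x - dotp (grad F x) (y - x)| <= `|L| * enorm (y - x) ^+ 2.
Proof.
move=> d H x y xr yr; have [t [t0 t1 ->]] := grad_mean_value F x y d.
rewrite -dotpBl (le_trans (normr_dotp_le _ _)) // expr2 mulrA ler_wpM2r //.
have zr : enorm (x + t *: (y - x)) <= r.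
  have -> : x + t *: (y - x) = t *: y + (1 - t) *: x.
    by rewrite scalerBr scalerBl scale1r addrCA addrA.
  have h := enorm_convex y x t t0 t1.
  have h1 : t * enorm y <= t * r by rewrite ler_wpM2l.
  have h2 : (1 - t) * enorm x <= (1 - t) * r by rewrite ler_wpM2l ?subr_ge0.
  lra.
rewrite (le_trans (H _ _ zr xr)) // (addrC x) addrK enormZ ger0_norm //.
apply: (@le_trans _ _ (`|L| * (t * enorm (y - x)))).
  by rewrite ler_wpM2r ?mulr_ge0 // ler_norm.
by rewrite ler_wpM2l // -[leRHS]mul1r ler_wpM2r.
Qed.

(* Two-sided first-order Taylor bounds, locally uniform in the base point,
   characterise C^{1,1}_loc and are stable under the operations used below. *)
Definition quad F g := forall r, exists C, forall x y,
  enorm x <= r -> enorm y <= r ->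
  `|F y - F x - dotp (g x) (y - x)| <= C * enorm (y - x) ^+ 2.

Lemma C11loc_quad F : C11loc F -> quad F (grad F).
Proof.
move=> [d H] r; have [L HL] := H 0 r; exists `|L|.
apply: lipschitz_grad_quad => // x y xr yr.
by apply: HL; rewrite /eball /= subr0.
Qed.

Lemma quad_grad F g : quad F g -> forall x, differentiable F x /\ grad F x = g x.
Proof.
move=> Q x; have [C HC] := Q (enorm x + 1).
apply: (@differentiable_quad _ _ _ C) => y yx; apply: HC; first by rewrite lerDl.
by rewrite (le_trans (enorm_leD y x)) // lerD2l.
Qed.

(** Compare the expansions from [x] and from [y] at a third point [y + w], where [w] is parallel to
    [g x - g y] and as long as [x - y]. The values of [F] cancel, leaving [dotp (g x - g y) w]. *)
Lemma quad_lipschitz F g r : quad F g -> exists2 L, 0 <= L & forall x y,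
  enorm x <= r -> enorm y <= r -> enorm (g x - g y) <= L * enorm (x - y).
Proof.
(* The radius leaves room for [y + w], as [w] has length at most [2 * r]. The factor is 6 = 1 + 4 +
   1, from increments of length at most [d], [2 * d] and [d]. *)
move=> Q; have [C HC] := Q (r + r + r); exists (`|C| * 6); first exact: mulr_ge0.
move=> x y xr yr; have [->|gxy] := eqVneq (g x) (g y).
  by rewrite subrr enorm0 !mulr_ge0.
have r0 : 0 <= r by rewrite (le_trans _ xr).
have g0 : 0 < enorm (g x - g y).
  rewrite lt_neqAle enorm_ge0 andbT eq_sym.
  by apply: contra gxy => /eqP/enorm_eq0/eqP; rewrite subr_eq0.
set d := enorm (x - y).
have d0 : 0 <= d by exact: enorm_ge0.
pose w := (d / enorm (g x - g y)) *: (g x - g y).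
have wd : enorm w = d.
  by rewrite enormZ ger0_norm ?divr_ge0 // divfK // gt_eqF.
have gw : dotp (g x - g y) w = d * enorm (g x - g y).
  by rewrite dotpZr -enorm_sqr expr2 mulrA divfK // gt_eqF.
have dr : d <= r + r by rewrite (le_trans (enormB_le _ _)) // lerD.
have ywr : enorm (y + w) <= r + r + r.
  by rewrite (le_trans (enormD_le _ _)) // wd; lra.
have xr3 : enorm x <= r + r + r by lra.
have yr3 : enorm y <= r + r + r by lra.
have h1 := HC y (y + w) yr3 ywr.
have h2 := HC x (y + w) xr3 ywr.
have h3 := HC x y xr3 yr3.
have n2 : enorm (y + w - x) <= 2 * d.
  rewrite addrAC (le_trans (enormD_le _ _)) // wd enormB -/d; lra.
have e1 : enorm (y + w - y) = d by rewrite addrC addKr.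
have e3 : enorm (y - x) = d by rewrite enormB.
have CM (s : R) : 0 <= s -> C * s <= `|C| * s by move=> s0; rewrite ler_wpM2r ?ler_norm.
have h2' : `|C| * enorm (y + w - x) ^+ 2 <= `|C| * (4 * d ^+ 2).
  rewrite ler_wpM2l // (_ : 4 * d ^+ 2 = (2 * d) ^+ 2); last by ring.
  by rewrite ler_pXn2r ?nnegrE // mulr_ge0.
have h1' := CM _ (sqr_ge0 (enorm (y + w - y))).
have h2'' := CM _ (sqr_ge0 (enorm (y + w - x))).
have h3' := CM _ (sqr_ge0 (enorm (y - x))).
have key : dotp (g x - g y) w <= `|C| * 6 * d ^+ 2.
  move: h1 h2 h3; rewrite !ler_norml => /andP[_ k1] /andP[k2 _] /andP[_ k3].
  move: gw k1 k2 k3 h1' h2' h3'; rewrite e1 e3 !dotpE; lra.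
rewrite gw in key.
have [d_eq0|dN0] := eqVneq d 0.
  have xy : x = y by apply/eqP; rewrite -subr_eq0; apply/eqP/enorm_eq0.
  by rewrite xy eqxx in gxy.
have dp : 0 < d by rewrite lt_neqAle eq_sym dN0.
rewrite -(ler_pM2l dp) (le_trans key) // expr2; lra.
Qed.

Lemma quad_C11loc F g : quad F g -> C11loc F.
Proof.
move=> Q; split=> [x|c r]; first by have [] := quad_grad F g Q x.
have [L L0 HL] := quad_lipschitz F g (enorm c + r) Q; exists L => x y xr yr.
have [_ ->] := quad_grad F g Q x; have [_ ->] := quad_grad F g Q y.
apply: HL; rewrite (le_trans (enorm_leD _ c)) // lerD2l //.
Qed.

Lemma quadD F1 F2 g1 g2 : quad F1 g1 -> quad F2 g2 ->
  quad (fun x => F1 x + F2 x) (fun x => g1 x + g2 x).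
Proof.
move=> Q1 Q2 r; have [C1 H1] := Q1 r; have [C2 H2] := Q2 r; exists (C1 + C2) => x y xr yr.
have -> : F1 y + F2 y - (F1 x + F2 x) - dotp (g1 x + g2 x) (y - x)
  = (F1 y - F1 x - dotp (g1 x) (y - x)) + (F2 y - F2 x - dotp (g2 x) (y - x)).
  by rewrite dotpDl; ring.
by rewrite (le_trans (ler_normD _ _)) // mulrDl lerD ?H1 ?H2.
Qed.

Lemma quadN F g : quad F g -> quad (fun x => - F x) (fun x => - g x).
Proof.
move=> Q r; have [C H] := Q r; exists C => x y xr yr.
rewrite -normrN; have := H _ _ xr yr; congr (_ <= _); congr `|_|.
by rewrite dotpNl; ring.
Qed.

Lemma quad_bounded F g r : quad F g -> exists M, forall x, enorm x <= r -> `|F x| <= M.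
Proof.
move=> Q; have [r0|r0] := leP 0 r; last first.
  by exists 0 => x xr; have := enorm_ge0 x; lra.
have [C H] := Q r; exists (`|F 0| + enorm (g 0) * r + `|C| * r ^+ 2) => x xr.
have := H 0 x; rewrite enorm0 subr0 => /(_ r0 xr) h.
have -> : F x = F 0 + dotp (g 0) x + (F x - F 0 - dotp (g 0) x) by ring.
rewrite (le_trans (ler_normD _ _)) // lerD //.
  rewrite (le_trans (ler_normD _ _)) // lerD2l (le_trans (normr_dotp_le _ _)) //.
  by rewrite ler_wpM2l.
rewrite (le_trans h) // (@le_trans _ _ (`|C| * enorm x ^+ 2)) //.
  by rewrite ler_wpM2r ?sqr_ge0 ?ler_norm.
by rewrite ler_wpM2l // ler_pXn2r ?nnegrE.
Qed.

End Quadratic.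

(** * Subgradients *)

Section Convexity.
Context {R : realType} {n : nat}.
Implicit Types (u v w x y z g : 'rV[R]_n) (F H m : 'rV[R]_n -> R) (c t r C L : R).

(** Plain real weights replace the packaged weights of [convex_function], so that linear arithmetic
    applies directly. *)
Definition cvx F := forall x y t, 0 <= t -> t <= 1 ->
  F (t *: x + (1 - t) *: y) <= t * F x + (1 - t) * F y.

Lemma convex_functionP F : convex_function setT F <-> cvx F.
Proof.
split=> [cF x y t t0 t1|cF t x y _ _]; last by apply: cF.
exact: (cF (Itv01 t0 t1) x y (mem_setT _) (mem_setT _)).
Qed.

Lemma cvx_affine (a : 'rV[R]_n) (b : R) : cvx (fun x => dotp a x + b).
Proof. by move=> x y t t0 t1; rewrite !dotpE; lra. Qed.

Definition subgrad F x g := forall y, F x + dotp g (y - x) <= F y.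

(** This is the one-dimensional step of the Hahn-Banach theorem: the slope along the new coordinate
    must lie between all lower and all upper difference quotients. *)
Lemma subgrad_ext_coord F (k : 'I_n) g : cvx F ->
  (forall u, (forall i : 'I_n, (k <= i)%N -> u 0 i = 0) -> dotp g u <= F u) ->
  exists g', forall u, (forall i : 'I_n, (k < i)%N -> u 0 i = 0) -> dotp g' u <= F u.
Proof.
move=> cF Hg; pose V : set 'rV[R]_n := [set u | forall i : 'I_n, (k <= i)%N -> u 0 i = 0].
have VD u v (s t : R) : V u -> V v -> V (s *: u + t *: v).
  by move=> Vu Vv i ki; rewrite !mxE Vu // Vv // !mulr0 addr0.
pose e : 'rV[R]_n := delta_mx 0 k.
(* The combination of [u - s *: e] and [v + t *: e] with weights [t / (s + t)] and [s / (s + t)] has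
   no [e] component, so [Hg] applies to it. *)
have key u v (s t : R) : V u -> V v -> 0 < s -> 0 < t ->
    (dotp g u - F (u - s *: e)) / s <= (F (v + t *: e) - dotp g v) / t.
  move=> Vu Vv s0 t0; rewrite ler_pdivrMr // mulrAC ler_pdivlMr //.
  have st0 : 0 < s + t by rewrite addr_gt0.
  have l0 : 0 <= t / (s + t) by rewrite divr_ge0 // ltW.
  have l1 : t / (s + t) <= 1 by rewrite ler_pdivrMr // mul1r; lra.
  have E1 : 1 - t / (s + t) = s / (s + t) by field; rewrite gt_eqF.
  have := cF (u - s *: e) (v + t *: e) _ l0 l1; rewrite E1.
  have -> : t / (s + t) *: (u - s *: e) + s / (s + t) *: (v + t *: e)
      = t / (s + t) *: u + s / (s + t) *: v.
    rewrite scalerBr scalerDr addrACA -[RHS]addr0; congr (_ + _).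
    rewrite -scaleNr !scalerA -scalerDl.
    by have -> : - (t / (s + t)) * s + s / (s + t) * t = 0; [ring|rewrite scale0r].
  move=> h; have := le_trans (Hg _ (VD _ _ _ _ Vu Vv)) h.
  rewrite !dotpE -(ler_pM2r st0) !mulrDl.
  have -> (p q : R) : p / (s + t) * q * (s + t) = p * q by field; rewrite gt_eqF.
  have -> (p q : R) : p / (s + t) * q * (s + t) = p * q by field; rewrite gt_eqF.
  have -> (p q : R) : p / (s + t) * q * (s + t) = p * q by field; rewrite gt_eqF.
  have -> (p q : R) : p / (s + t) * q * (s + t) = p * q by field; rewrite gt_eqF.
  by lra.
have V0 : V 0 by move=> i _; rewrite mxE.
pose A := [set a | exists u s, [/\ V u, 0 < s & a = (dotp g u - F (u - s *: e)) / s]].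
have A0 : A !=set0 by exists ((dotp g 0 - F (0 - 1 *: e)) / 1), 0, 1.
have Aub v t : V v -> 0 < t -> ubound A ((F (v + t *: e) - dotp g v) / t).
  by move=> Vv t0 _ [u [s [Vu s0 ->]]]; apply: key.
have Asup : has_sup A by split => //; eexists; exact: (Aub 0 1 V0 ltr01).
(* Subtracting [g 0 k] removes the old slope along [e], so that the new one is exactly [sup A]. *)
exists (g + (sup A - g 0 k) *: e) => w Hw.
pose s := w 0 k; pose u := w - s *: e.
have Vu : V u.
  move=> i; rewrite leq_eqVlt => /orP[/eqP/val_inj <-|ki].
    by rewrite !mxE !eqxx mulr1 subrr.
  rewrite !mxE Hw // (_ : i == k = false) ?andbF ?mulr0 ?subrr //.
  by apply/negbTE; rewrite -val_eqE /= gtn_eqF.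
have wE : w = u + s *: e by rewrite /u subrK.
clearbody u s.
have gw : dotp (g + (sup A - g 0 k) *: e) w = dotp g u + s * sup A.
  have eu : dotp e u = 0 by rewrite dotpC dotp_delta Vu.
  have ee : dotp e e = 1 by rewrite dotp_delta mxE !eqxx.
  by rewrite wE !dotpE eu ee dotp_delta; ring.
rewrite gw; have [s0|s0|s0] := ltgtP s 0.
- have sN : 0 < - s by rewrite oppr_gt0.
  have : A ((dotp g u - F (u - (- s) *: e)) / - s) by exists u, (- s).
  move/(ub_le_sup Asup.2).
  by rewrite ler_pdivrMr // scaleNr opprK -wE; lra.
- have := ge_sup A0 (Aub u s Vu s0).
  by rewrite ler_pdivlMr // -wE; lra.
- by rewrite s0 mul0r addr0 wE s0 scale0r addr0; apply: Hg.
Qed.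

(** After moving [x] to the origin, the supporting functional is built one coordinate at a time,
    starting from the zero subspace. *)
Lemma subgrad_exists F x : cvx F -> exists g, subgrad F x g.
Proof.
move=> cF; pose P u := F (u + x) - F x.
have cP : cvx P.
  move=> u v t t0 t1; have := cF (u + x) (v + x) t t0 t1.
  rewrite /P (_ : t *: u + (1 - t) *: v + x = t *: (u + x) + (1 - t) *: (v + x)); first lra.
  by rewrite !scalerDr [RHS]addrACA -[in RHS]scalerDl (addrC t) subrK scale1r.
suff /(_ n (leqnn n)) [g Hg] : forall k, (k <= n)%N -> exists g,
    forall u, (forall i : 'I_n, (k <= i)%N -> u 0 i = 0) -> dotp g u <= P u.
  exists g => y; have := Hg (y - x).
  rewrite /P subrK => H; rewrite -lerBrDl H // => i; by rewrite leqNgt ltn_ord.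
elim=> [|k IH] kn.
  exists 0 => u u0; rewrite dotp0l (_ : u = 0); first by rewrite /P add0r subrr.
  by apply/rowP => i; rewrite mxE u0.
have [g Hg] := IH (ltnW kn).
exact: (@subgrad_ext_coord P (Ordinal kn) g cP Hg).
Qed.

End Convexity.

(** * Smoothness of convex envelopes *)

Section Envelope.
Context {R : realType} {n : nat}.
Implicit Types (u v w x y z g : 'rV[R]_n) (F H m : 'rV[R]_n -> R) (c t r C L : R).

Lemma dotp_ge_oppr u v : - (enorm u * enorm v) <= dotp u v.
Proof. by have := normr_dotp_le u v; rewrite ler_norml => /andP[]. Qed.

(** A unit step in the direction of [g] raises the supporting function by [enorm g]. *)
Lemma subgrad_enorm_le F x g (lo hi : R) : subgrad F x g -> lo <= F x ->
  (forall y, enorm (y - x) <= 1 -> F y <= hi) -> enorm g <= hi - lo.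
Proof.
move=> sg lox hiF; have [g0|g0] := eqVneq (enorm g) 0.
  by rewrite g0 subr_ge0 (le_trans lox) // hiF // subrr enorm0.
have h := sg (x + (enorm g)^-1 *: g).
have := hiF (x + (enorm g)^-1 *: g); move: h.
rewrite (addrC x) addrK dotpZr -enorm_sqr expr2 mulKf // enormZ.
rewrite ger0_norm ?invr_ge0 // mulVf // => h /(_ (lexx _)); lra.
Qed.

(** [N] is left free so that growth along single directions, [N x = |<w, x>|], can be added up to
    growth in the norm. *)
Definition grows_like H (N : 'rV[R]_n -> R) := exists a (b c : R), 0 < c /\
  forall x, dotp a x + c * N x - b <= H x.

Definition coercive H := grows_like H (@enorm R n).

Definition locally_semiconcave m := forall r, exists C, forall x k,
  enorm x <= r -> enorm k <= 1 ->
  m (x + k) + m (x - k) - 2 * m x <= C * enorm k ^+ 2.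

Variables (H m : 'rV[R]_n -> R).
Hypothesis cH : cvx H.
Hypothesis Hm : forall x, H x <= m x.
Hypothesis maxH : forall h : 'rV[R]_n -> R,
  cvx h -> (forall x, h x <= m x) -> forall x, h x <= H x.
Hypothesis coH : coercive H.
Hypothesis semim : locally_semiconcave m.
Hypothesis bdH : forall r, exists M, forall x, enorm x <= r -> H x <= M.

(* Semiconcavity of m lifts the mean of two supporting affine functions of H
   by a multiple of |g1 - g0|^2. *)
Lemma semiconcave_above_mean C1 x x0 x1 g0 g1 (k := (4 * C1)^-1 *: (g1 - g0)) :
  0 < C1 -> subgrad H x0 g0 -> subgrad H x1 g1 ->
  m (x + k) + m (x - k) - 2 * m x <= 2 * C1 * enorm k ^+ 2 ->
  ((H x0 + dotp g0 (x - x0)) + (H x1 + dotp g1 (x - x1))) / 2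
    + enorm (g1 - g0) ^+ 2 / (16 * C1) <= m x.
Proof.
move=> C0 s0 s1 hm.
have h0 := le_trans (s0 (x - k)) (Hm _).
have h1 := le_trans (s1 (x + k)) (Hm _).
have E0 : dotp g0 (x - k - x0) = dotp g0 (x - x0) - dotp g0 k.
  by rewrite addrAC [LHS]dotpBr.
have E1 : dotp g1 (x + k - x1) = dotp g1 (x - x1) + dotp g1 k.
  by rewrite addrAC [LHS]dotpDr.
have Ek : dotp g1 k - dotp g0 k = enorm (g1 - g0) ^+ 2 / (4 * C1).
  by rewrite -dotpBl dotpZr enorm_sqr mulrC.
have Ek2 : 2 * C1 * enorm k ^+ 2 = enorm (g1 - g0) ^+ 2 / (8 * C1).
  rewrite enormZ exprMn -normrX ger0_norm ?sqr_ge0 //.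
  by field; rewrite gt_eqF.
have D4 : enorm (g1 - g0) ^+ 2 / (4 * C1) = 4 * (enorm (g1 - g0) ^+ 2 / (16 * C1)).
  by field; rewrite gt_eqF.
have D8 : enorm (g1 - g0) ^+ 2 / (8 * C1) = 2 * (enorm (g1 - g0) ^+ 2 / (16 * C1)).
  by field; rewrite gt_eqF.
rewrite D4 in Ek; rewrite Ek2 D8 in hm; rewrite E0 in h0; rewrite E1 in h1.
by move: (enorm (g1 - g0) ^+ 2 / (16 * C1)) Ek hm => q; lra.
Qed.

Lemma subgrad_lipschitz r : exists2 L, 0 <= L & forall x0 x1 g0 g1,
  enorm x0 <= r -> enorm x1 <= r -> subgrad H x0 g0 -> subgrad H x1 g1 ->
  enorm (g0 - g1) <= L * enorm (x0 - x1).
Proof.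
have [r0|r0] := ltP r 0.
  by exists 0 => // x0 x1 g0 g1 h; have := enorm_ge0 x0; lra.
have [a [b [c [c0 coer]]]] := coH.
have [M1 HM1] := bdH (r + 1).
pose M0 := enorm a * r + b.
have lowH x : enorm x <= r -> - M0 <= H x.
  move=> xr; have := coer x; have := dotp_ge_oppr a x.
  have : enorm a * enorm x <= enorm a * r by rewrite ler_wpM2l.
  have : 0 <= c * enorm x by rewrite mulr_ge0 // ltW.
  by rewrite /M0; lra.
pose S := M1 + M0.
have slope x g : enorm x <= r -> subgrad H x g -> enorm g <= S.
  move=> xr sg; have := @subgrad_enorm_le H x g (- M0) M1 sg (lowH _ xr).
  rewrite opprK; apply => y yx; apply: HM1.
  by rewrite (le_trans (enorm_leD y x)) // lerD.
(* [D] makes [kap] exceed [H + 1] on the small ball. The rate [c / 2], half that of [H], makes [kap]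
   drop below [H] outside radius [Rb]. *)
pose D := M1 + enorm a * r + 1.
pose kap x := dotp a x + c / 2 * enorm x + D.
have kap_big x : enorm x <= r -> H x + 1 <= kap x.
  move=> xr; have := HM1 x (le_trans xr _); rewrite lerDl => /(_ ler01).
  have := dotp_ge_oppr a x.
  have : enorm a * enorm x <= enorm a * r by rewrite ler_wpM2l.
  have : 0 <= c / 2 * enorm x by rewrite mulr_ge0 // divr_ge0 // ltW.
  by rewrite /kap /D; lra.
have S0 : 0 <= S.
  have x0 : enorm (0 : 'rV[R]_n) <= r by rewrite enorm0.
  have := lowH _ x0; have := HM1 0 (le_trans x0 _); rewrite lerDl => /(_ ler01).
  by rewrite /S; lra.
pose Rb := r + `|2 * (b + D) / c|.
have Rb0 : 0 <= Rb by rewrite addr_ge0.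
have kap_small x : Rb <= enorm x -> kap x <= H x.
  move=> xR; apply: le_trans (coer x); rewrite /kap.
  have : b + D <= c / 2 * enorm x.
    have : 2 * (b + D) / c <= enorm x.
      rewrite (le_trans (ler_norm _)) // (le_trans _ xR) // /Rb lerDr //.
    rewrite ler_pdivrMr //; lra.
  by lra.
have [C HC] := semim Rb.
(* Large enough for three purposes: [C <= 2 * C1], the step [k] has length at most 1, and
   [t <= 1]. *)
pose C1 := `|C| / 2 + S ^+ 2 + S + 1.
have C1S : S ^+ 2 + S + 1 <= C1 by rewrite /C1 -!addrA lerDr divr_ge0.
have S20 : 0 <= S ^+ 2 by exact: sqr_ge0.
have C10 : 0 < C1 by lra.
have CC1 : C <= 2 * C1.
  have := ler_norm C; have : `|C| / 2 + (S ^+ 2 + S + 1) <= C1 by rewrite /C1 !addrA.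
  lra.
(* [M] bounds [kap - p] on the ball of radius [Rb], for every choice of the two supporting
   functions. *)
pose M := 1 + `|enorm a * Rb + c / 2 * Rb + D + M0 + S * (Rb + r)|.
have M_1 : 1 <= M by rewrite lerDl.
have M_0 : 0 < M by lra.
exists (4 * C1 * M); first by rewrite !mulr_ge0 // ltW.
move=> x0 x1 g0 g1 x0r x1r s0 s1.
have n0 := slope _ _ x0r s0; have n1 := slope _ _ x1r s1.
pose v := g1 - g0.
have vS : enorm v <= 2 * S by rewrite (le_trans (enormB_le _ _)) //; lra.
pose p x := ((H x0 + dotp g0 (x - x0)) + (H x1 + dotp g1 (x - x1))) / 2.
(* With this weight [t * M] is exactly the gain in [semiconcave_above_mean]. *)
pose t := enorm v ^+ 2 / (16 * C1) / M.
have v2 : enorm v ^+ 2 <= 4 * S ^+ 2.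
  by rewrite (_ : 4 * S ^+ 2 = (2 * S) ^+ 2) ?ler_pXn2r ?nnegrE ?mulr_ge0 //; ring.
have t0 : 0 <= t by rewrite /t !divr_ge0 ?sqr_ge0 // ?mulr_ge0 // ltW.
have t1 : t <= 1.
  rewrite /t ler_pdivrMr // mul1r ler_pdivrMr ?mulr_gt0 //.
  apply: (@le_trans _ _ (1 * (16 * C1))); last by rewrite ler_wpM2r // mulr_ge0 // ltW.
  by lra.
have tM : t * M = enorm v ^+ 2 / (16 * C1) by rewrite /t divfK // gt_eqF.
have pH x : p x <= H x by have := s0 x; have := s1 x; rewrite /p; lra.
have low_aff x y g : enorm x <= Rb -> enorm y <= r -> subgrad H y g ->
    - (M0 + S * (Rb + r)) <= H y + dotp g (x - y).
  move=> xR yr sg; have := lowH _ yr; have := dotp_ge_oppr g (x - y).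
  have : enorm g * enorm (x - y) <= S * (Rb + r).
    apply: ler_pM => //; first exact: slope sg.
    by rewrite (le_trans (enormB_le _ _)) // lerD.
  by lra.
have gap x : enorm x <= Rb -> kap x - p x <= M.
  move=> xR; have := low_aff _ _ _ xR x0r s0; have := low_aff _ _ _ xR x1r s1.
  have := dotp_le a x.
  have : enorm a * enorm x <= enorm a * Rb by rewrite ler_wpM2l.
  have : c / 2 * enorm x <= c / 2 * Rb by rewrite ler_wpM2l // divr_ge0 // ltW.
  have := ler_norm (enorm a * Rb + c / 2 * Rb + D + M0 + S * (Rb + r)).
  by rewrite /M /kap /p; lra.
pose k := (4 * C1)^-1 *: v.
have k1 : enorm k <= 1.
  rewrite enormZ ger0_norm ?invr_ge0 ?mulr_ge0 ?(ltW C10) //.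
  by rewrite mulrC ler_pdivrMr ?mulr_gt0 // mul1r; lra.
have inside x : enorm x <= Rb -> p x + t * M <= m x.
  move=> xR; rewrite tM; apply: semiconcave_above_mean => //.
  rewrite (le_trans (HC _ _ xR k1)) // ler_wpM2r // sqr_ge0 //.
(* Within radius [Rb], [q = p + t * (kap - p)] is at most [p + t * M], hence at most [m]; beyond it
   both [p] and [kap] lie below [H]. *)
pose q x := (1 - t) * p x + t * kap x.
have cq : cvx q.
  move=> x y s h0 h1; rewrite /q /p /kap.
  have := enorm_convex x y s h0 h1.
  have tc : 0 <= t * (c / 2) by rewrite mulr_ge0 // divr_ge0 // ltW.
  move/(ler_wpM2l tc); rewrite !dotpE; lra.
have qm x : q x <= m x.
  have [xR|xR] := leP (enorm x) Rb.
    have := inside x xR; have := ler_wpM2l t0 (gap x xR); rewrite /q; lra.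
  have h1 := ler_wpM2l t0 (kap_small x (ltW xR)).
  have ht : 0 <= 1 - t by lra.
  have h2 := ler_wpM2l ht (pH x).
  by have := Hm x; rewrite /q; lra.
have qH := maxH q cq qm.
have lift x : enorm x <= r -> p x + t <= H x.
  move=> xr; have := qH x; rewrite /q.
  have h1 := ler_wpM2l t0 (kap_big x xr).
  have h2 := ler_wpM2l t0 (pH x); lra.
have l0 := lift _ x0r; have l1 := lift _ x1r.
rewrite /p !subrr !dotp0r !addr0 in l0 l1.
(* Adding [l0] and [l1] cancels the values of [H] and leaves only the cross terms. *)
have key : 4 * t <= dotp v (x1 - x0).
  move: l0 l1; rewrite /v -(opprB x0 x1) dotpBl !dotpNr; lra.
have key2 : enorm v ^+ 2 <= 4 * C1 * M * (enorm v * enorm (x0 - x1)).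
  have E : enorm v ^+ 2 = 16 * C1 * M * t.
    by rewrite /t; field; rewrite !gt_eqF.
  have : 4 * t <= enorm v * enorm (x0 - x1).
    by rewrite (le_trans key) // (enormB x0) dotp_le.
  have : 0 <= 4 * C1 * M by rewrite !mulr_ge0 // ltW.
  rewrite E => h /(ler_wpM2l h); lra.
rewrite (enormB g0) -/v; have [->|vN] := eqVneq (enorm v) 0.
  by rewrite !mulr_ge0 // ltW.
have vp : 0 < enorm v by rewrite lt_neqAle eq_sym vN enorm_ge0.
rewrite -(ler_pM2l vp) -expr2 (le_trans key2) //.
by rewrite !mulrA [_ * enorm v]mulrC !mulrA.
Qed.

(** For any selection [g] of subgradients the Taylor remainder lies between 0 and
    [dotp (g y - g x) (y - x)], which is quadratic by [subgrad_lipschitz]. That lemma with equal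
    base points also gives uniqueness of the subgradient. *)
Lemma envelope_quad : exists2 g, quad H g &
  forall x a, subgrad H x a -> g x = a.
Proof.
have /choice[g Hg] : forall x, exists g, subgrad H x g.
  by move=> x; exact: subgrad_exists.
exists g => [r|x a xa]; last first.
  have [L _ HL] := subgrad_lipschitz (enorm x).
  have := HL x x (g x) a (lexx _) (lexx _) (Hg x) xa.
  rewrite subrr enorm0 mulr0 => h; apply/eqP; rewrite -subr_eq0.
  by apply/eqP/enorm_eq0/eqP; rewrite eq_le h enorm_ge0.
have [L L0 HL] := subgrad_lipschitz r; exists L => x y xr yr.
have h1 := Hg x y; have h2 := Hg y x.
have h3 := HL _ _ _ _ yr xr (Hg y) (Hg x).
have := dotp_le (g y - g x) (y - x).
have := ler_wpM2r (enorm_ge0 (y - x)) h3; rewrite -mulrA -expr2.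
move: h1 h2; rewrite -(opprB y x) dotpNr dotpBl ler_norml => *.
by apply/andP; split; lra.
Qed.

End Envelope.

(** * The envelope of a jet *)

Section Coercivity.
Context {R : realType} {n : nat}.
Variable H : 'rV[R]_n -> R.
Implicit Types N : 'rV[R]_n -> R.

Lemma grows_like_le N N' (k : R) : 0 < k -> (forall x, N' x <= k * N x) ->
  grows_like H N -> grows_like H N'.
Proof.
move=> k0 le [a [b [c [c0 h]]]]; exists a, b, (c / k); rewrite divr_gt0 //; split=> // x.
apply: le_trans (h x); rewrite lerB // lerD // -mulrA ler_pM2l // ler_pdivrMl //.
Qed.

Lemma grows_likeD N1 N2 : (forall x, 0 <= N1 x) -> (forall x, 0 <= N2 x) ->
  grows_like H N1 -> grows_like H N2 -> grows_like H (fun x => N1 x + N2 x).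
Proof.
move=> N10 N20 [a1 [b1 [c1 [c10 h1]]]] [a2 [b2 [c2 [c20 h2]]]].
pose c := Num.min c1 c2.
have c0 : 0 < c by rewrite lt_min c10.
have cc1 : c <= c1 by rewrite ge_min lexx.
have cc2 : c <= c2 by rewrite ge_min lexx orbT.
exists (2^-1 *: (a1 + a2)), ((b1 + b2) / 2), (c / 2); rewrite divr_gt0 //; split=> // x.
have := h1 x; have := h2 x; rewrite !dotpE.
have := ler_wpM2r (N10 x) cc1; have := ler_wpM2r (N20 x) cc2; lra.
Qed.

Lemma grows_like_sum I (s : seq I) (N : I -> 'rV[R]_n -> R) :
  (forall i x, 0 <= N i x) -> grows_like H (fun=> 0) -> (forall i, grows_like H (N i)) ->
  grows_like H (fun x => \sum_(i <- s) N i x).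
Proof.
move=> N0 g0 gN; elim: s => [|i s IH].
  by apply: grows_like_le ltr01 _ g0 => x; rewrite big_nil mulr0.
have s0 x : 0 <= \sum_(j <- s) N j x by apply: sumr_ge0.
apply: grows_like_le ltr01 _ (grows_likeD _ _ (N0 i) s0 (gN i) IH) => x.
by rewrite mul1r big_cons.
Qed.

(** The maximum of two affine functions is their mean plus half the absolute value of their
    difference. *)
Lemma grows_like_diff (a1 a2 : 'rV[R]_n) (b1 b2 : R) :
  (forall x, b1 + dotp a1 x <= H x) -> (forall x, b2 + dotp a2 x <= H x) ->
  grows_like H (fun x => `|dotp (a1 - a2) x|).
Proof.
move=> h1 h2.
exists (2^-1 *: (a1 + a2)), (`|b1 - b2| / 2 - (b1 + b2) / 2), 2^-1; split=> [|x].
  by rewrite invr_gt0.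
have := h1 x; have := h2 x; rewrite !dotpE.
have -> : dotp a1 x - dotp a2 x
  = (b1 + dotp a1 x - (b2 + dotp a2 x)) - (b1 - b2) by ring.
have := ler_normB (b1 + dotp a1 x - (b2 + dotp a2 x)) (b1 - b2).
have [] := ger0P (b1 + dotp a1 x - (b2 + dotp a2 x)); lra.
Qed.

(** Coordinate functionals are combinations of functionals from [S], and the sum of the absolute
    coordinates dominates the Euclidean norm. *)
Lemma coercive_span (S : set 'rV[R]_n) : lin_span S = setT ->
  grows_like H (fun=> 0) -> (forall w, S w -> grows_like H (fun x => `|dotp w x|)) ->
  coercive H.
Proof.
move=> ST g0 gS.
have gv v : grows_like H (fun x => `|dotp v x|).
  have [k [c [w [Sw ->]]]] : lin_span S v by rewrite ST.
  have : grows_like H (fun x => \sum_(i <- index_enum 'I_k) `|dotp (c i *: w i) x|).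
    apply: grows_like_sum => // i.
    (* The summand 1 keeps the factor positive when [c i] vanishes. *)
    apply: (@grows_like_le _ _ (`|c i| + 1)) (gS _ (Sw i)); first by rewrite ltr_wpDl.
    by move=> x; rewrite dotpZl normrM mulrDl lerDl mul1r.
  apply: grows_like_le ltr01 _ => x; rewrite mul1r.
  elim/big_rec2: _ => [|i y u _ h]; first by rewrite dotp0l normr0.
  by rewrite dotpDl (le_trans (ler_normD _ _)) // lerD2l.
have : grows_like H (fun x => \sum_(i <- index_enum 'I_n) `|dotp (delta_mx 0 i) x|).
  by apply: grows_like_sum => // i; exact: gv.
apply: grows_like_le ltr01 _ => x; rewrite mul1r (le_trans (enorm_le_sum x)) //.
by apply: ler_sum => i _; rewrite dotpC dotp_delta.
Qed.

End Coercivity.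

(** * The convex envelope as the largest convex minorant *)

Section ConvexEnvelope.
Context {R : realType} {n : nat}.
Variables (m h0 : 'rV[R]_n -> R).
Hypotheses (ch0 : cvx h0) (h0m : forall x, h0 x <= m x).

Let minorants x := [set t : R | exists h : 'rV[R]_n -> R,
  [/\ convex_function setT h, forall u, h u <= m u & t = h x]].

(** Together with [minorants_ub], this rules out the default value of [sup] in [conv_env]. *)
Let minorants_neq0 x : minorants x !=set0.
Proof. by exists (h0 x), h0; split=> //; apply/convex_functionP. Qed.

Let minorants_ub x : ubound (minorants x) (m x).
Proof. by move=> _ [h [_ hm ->]]. Qed.

Lemma conv_env_le x : conv_env m x <= m x.
Proof. exact: (ge_sup (minorants_neq0 x) (@minorants_ub x)). Qed.

Lemma le_conv_env h : cvx h -> (forall x, h x <= m x) ->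
  forall x, h x <= conv_env m x.
Proof.
move=> ch hm x; apply: ub_le_sup; first by exists (m x); exact: minorants_ub.
by exists h; split=> //; apply/convex_functionP.
Qed.

Lemma cvx_conv_env : cvx (conv_env m).
Proof.
move=> x y t t0 t1; apply: (ge_sup (minorants_neq0 _)) => _ [h [/convex_functionP ch hm ->]].
have h1 := ler_wpM2l t0 (le_conv_env h ch hm x).
have t1' : 0 <= 1 - t by lra.
have h2 := ler_wpM2l t1' (le_conv_env h ch hm y).
have := ch x y t t0 t1; lra.
Qed.

End ConvexEnvelope.

(** * The envelope formula extends the jet *)

Section JetEnvelope.
Context {R : realType} {n : nat}.
Variables (E : set 'rV[R]_n) (f : 'rV[R]_n -> R) (G : 'rV[R]_n -> 'rV[R]_n).
Variables (psi : 'rV[R]_n -> R) (phi : 'rV[R]_n -> 'rV[R]_n -> R) (a : R).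
Hypotheses (JC : jet_conditions E f G psi phi) (a0 : 0 < a).
Variables (y0 : 'rV[R]_n) (Ey0 : E y0).

Let A (y : 'rV[R]_n) : 'rV[R]_n := G y + grad psi y.
Let ell (y x : 'rV[R]_n) : R := f y + psi y + dotp (A y) (x - y).
Let P (y x : 'rV[R]_n) : R := ell y x + phi y x + a * enorm (x - y) ^+ 2.
Let m := jet_inf E f G psi phi a.
Let H := conv_env m.

Implicit Types x y z : 'rV[R]_n.

Let sq_ge0 x y : 0 <= a * enorm (x - y) ^+ 2.
Proof. by rewrite mulr_ge0 ?sqr_ge0 // ltW. Qed.

(** The surplus [a * enorm (x - y) ^+ 2] over every tangent is what later removes distant [y] from
    the infimum. *)
Let ell_le y z x : E y -> E z -> ell z x + a * enorm (x - y) ^+ 2 <= P y x.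
Proof.
move=> Ey Ez; rewrite /P lerD2r.
by case: JC => _ [_ [_ [_ [_ h]]]]; exact: h.
Qed.

Let ell_le_jet_inf z x : E z -> ell z x <= m x.
Proof.
move=> Ez; apply: lb_le_inf; first by exists (P y0 x), y0.
move=> _ [y Ey <-]; apply: le_trans (ell_le y z x Ey Ez).
by rewrite lerDl.
Qed.

Let jet_inf_le y x : E y -> m x <= P y x.
Proof.
move=> Ey; apply: ge_inf; last by exists y.
exists (ell y0 x) => _ [z Ez <-]; apply: le_trans (ell_le z y0 x Ez Ey0).
by rewrite lerDl.
Qed.

Let cvx_ell y : cvx (ell y).
Proof.
move=> x z t t0 t1; have := cvx_affine (A y) (f y + psi y - dotp (A y) y) x z t t0 t1.
by rewrite /ell !dotpE; lra.
Qed.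

Let ell_le_env z x : E z -> ell z x <= H x.
Proof. by move=> Ez; apply: le_conv_env => // u; apply: ell_le_jet_inf. Qed.

Let env_le_jet_inf x : H x <= m x.
Proof. by apply: (conv_env_le m (ell y0)) => // u; exact: ell_le_jet_inf. Qed.

(** At [y] the envelope is squeezed between the tangent [ell y] and the competitor [P y], which
    agree there. *)
Let env_on y : E y -> H y = f y + psi y.
Proof.
move=> Ey; apply/eqP; rewrite eq_le; apply/andP; split.
  rewrite (le_trans (env_le_jet_inf y)) // (le_trans (jet_inf_le y y Ey)) //.
  case: JC => _ [_ [_ [/(_ y Ey)[phi0 _] _]]].
  by rewrite /P /ell subrr dotp0r enorm0 phi0 expr0n mulr0 !addr0.
by have := ell_le_env y y Ey; rewrite /ell subrr dotp0r addr0.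
Qed.

Let env_subgrad y : E y -> subgrad H y (A y).
Proof. by move=> Ey x; rewrite env_on //; exact: ell_le_env. Qed.

Let P_bounded r : exists M, forall x, enorm x <= r -> P y0 x <= M.
Proof.
case: JC => _ [/(_ y0 Ey0)[/C11loc_quad Q _] _]; have [M HM] := quad_bounded _ _ r Q.
exists (f y0 + psi y0 + enorm (A y0) * (`|r| + enorm y0) + M
  + a * (`|r| + enorm y0) ^+ 2) => x xr.
have xy : enorm (x - y0) <= `|r| + enorm y0.
  by rewrite (le_trans (enormB_le _ _)) // lerD2r (le_trans xr) ?ler_norm.
rewrite /P /ell !lerD //.
- by rewrite (le_trans (dotp_le _ _)) // ler_wpM2l.
- exact: le_trans (ler_norm _) (HM x xr).
- by rewrite ler_pM2l // ler_pXn2r ?nnegrE ?addr_ge0.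
Qed.

Let env_bounded r : exists M, forall x, enorm x <= r -> H x <= M.
Proof.
have [M HM] := P_bounded r; exists M => x xr.
by rewrite (le_trans (env_le_jet_inf x)) // (le_trans (jet_inf_le y0 x Ey0)) ?HM.
Qed.

(** Two tangents below [H] force growth along the difference of their slopes, and these differences
    span. *)
Let env_coercive : coercive H.
Proof.
have grows_likeA y z : E y -> E z -> grows_like H (fun x => `|dotp (A y - A z) x|).
  move=> Ey Ez.
  apply: (@grows_like_diff _ _ _ _ _ (f y + psi y - dotp (A y) y)
    (f z + psi z - dotp (A z) z)) => x.
    by have := ell_le_env y x Ey; rewrite /ell dotpBr; lra.
  by have := ell_le_env z x Ez; rewrite /ell dotpBr; lra.
case: JC => _ [_ [spanT _]]; apply: (coercive_span _ _ spanT).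
  apply: grows_like_le ltr01 _ (grows_likeA y0 y0 Ey0 Ey0) => x.
  by rewrite mul1r.
move=> w [y Ey [z Ez <-]]; rewrite -[_ - G z - _]addrA -opprD.
exact: grows_likeA.
Qed.

Let phi_quad r : 0 < r -> exists2 L, 0 <= L & forall y, E y -> enorm y <= r ->
  forall x z, enorm x <= r -> enorm z <= r ->
  `|phi y z - phi y x - dotp (grad (phi y) x) (z - x)| <= L * enorm (z - x) ^+ 2.
Proof.
move=> r0; case: JC => _ [C11 [_ [_ [/(_ r r0) supL _]]]].
move: supL; set Q := [set q | _] => supL.
(* The supremum is taken in the extended reals: [+oo] is excluded by [supL], and [-oo] means that
   [Q] is empty, so any constant works. *)
have [L HL] : exists L : R, forall q, Q q%:E -> q <= L.
  case: (ereal_sup Q) (@ereal_sup_ubound _ Q) supL => [L ubQ _|//|ubQ _].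
    by exists L => q /ubQ; rewrite lee_fin.
  by exists 0 => q /ubQ; rewrite leeNy_eq.
exists `|L| => // y Ey yr; have [[d _] _] := C11 y Ey.
apply: lipschitz_grad_quad => // x z xr zr.
have [->|xz] := eqVneq x z; first by rewrite !subrr !enorm0 mulr0.
have xz0 : 0 < enorm (x - z).
  rewrite lt_neqAle enorm_ge0 andbT eq_sym.
  by apply: contra xz => /eqP/enorm_eq0/eqP; rewrite subr_eq0.
rewrite -ler_pdivrMr //; apply: HL; exists x, z, y.
by split=> //; rewrite /eball /= ?subr0 //; split=> //; rewrite /eball /= subr0.
Qed.

(** It suffices to bound the mean of [m] at [x + k] and [x - k] by each competitor [P y x] up to the
    quadratic term. For [y] near, [phi y] contributes [2 * L] and the parallelogram law [2 * a]; for
    [y] far, [P y x] already exceeds the local bound of [m]. *)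
Let jet_inf_semiconcave : locally_semiconcave m.
Proof.
move=> r; have [r0|r0] := ltP r 0.
  by exists 0 => x k h; have := enorm_ge0 x; lra.
have [M HM] := P_bounded (r + 1).
pose B := enorm (A y0) * (r + enorm y0) - (f y0 + psi y0).
have lowell x : enorm x <= r -> - B <= ell y0 x.
  move=> xr; have := dotp_ge_oppr (A y0) (x - y0).
  have : enorm (A y0) * enorm (x - y0) <= enorm (A y0) * (r + enorm y0).
    by rewrite ler_wpM2l // (le_trans (enormB_le _ _)) // lerD2r.
  by rewrite /B /ell; lra.
(* At distance at least [s] the penalty is at least [a * s ^+ 2 >= a * s >= M + B], which lifts
   [ell y0 x >= - B] above [M]. *)
pose s := `|(M + B) / a| + 1.
have s1 : 1 <= s by rewrite lerDr.
have sMB : M + B <= a * s.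
  rewrite mulrC -ler_pdivrMr // (le_trans (ler_norm _)) //.
  by rewrite lerDl.
pose rho := r + s.
have [|L L0 HL] := phi_quad (rho + 1); first by rewrite /rho; lra.
exists (2 * L + 2 * a) => x k xr k1.
have mM z : enorm z <= r + 1 -> m z <= M.
  by move=> zr; rewrite (le_trans (jet_inf_le y0 z Ey0)) // HM.
have xk : enorm (x + k) <= r + 1 by rewrite (le_trans (enormD_le _ _)) // lerD.
have xk' : enorm (x - k) <= r + 1 by rewrite (le_trans (enormB_le _ _)) // lerD.
suff : (m (x + k) + m (x - k) - (2 * L + 2 * a) * enorm k ^+ 2) / 2 <= m x by lra.
apply: lb_le_inf; first by exists (P y0 x), y0.
move=> _ [y Ey <-]; change ((m (x + k) + m (x - k)
  - (2 * L + 2 * a) * enorm k ^+ 2) / 2 <= P y x).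
have k20 := sqr_ge0 (enorm k).
have C0 : 0 <= (2 * L + 2 * a) * enorm k ^+ 2.
  by rewrite mulr_ge0 // addr_ge0 ?mulr_ge0 // ltW.
have [yr|yr] := leP (enorm y) rho; last first.
  have := ell_le y y0 x Ey Ey0; have := lowell x xr.
  have d1 : s <= enorm (x - y).
    by have := enorm_leD y x; rewrite (enormB y) /rho in yr *; lra.
  have : a * s <= a * enorm (x - y) ^+ 2.
    rewrite ler_pM2l // (le_trans d1) // expr2 -{1}[enorm (x - y)]mul1r ler_wpM2r //.
    exact: le_trans d1.
  have := mM _ xk; have := mM _ xk'; lra.
have yr' : enorm y <= rho + 1 by lra.
have rr : r + 1 <= rho + 1 by rewrite /rho; lra.
have xr' : enorm x <= rho + 1 by lra.
have h1 := HL y Ey yr' x (x + k) xr' (le_trans xk rr).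
have h2 := HL y Ey yr' x (x - k) xr' (le_trans xk' rr).
have e1 : x + k - x = k by rewrite addrC addKr.
have e2 : x - k - x = - k by rewrite addrC addKr.
rewrite e1 in h1; rewrite e2 enormN dotpNr in h2.
have h3 := jet_inf_le y (x + k) Ey; have h4 := jet_inf_le y (x - k) Ey.
have e3 : enorm (x + k - y) ^+ 2 + enorm (x - k - y) ^+ 2
    = 2 * enorm (x - y) ^+ 2 + 2 * enorm k ^+ 2.
  by rewrite !enorm_sqr !dotpE (dotpC k x) (dotpC y x) (dotpC k y); ring.
have e4 := congr1 (fun q => a * q) e3.
move: h1 h2; rewrite !ler_norml => /andP[_ h1] /andP[_ h2].
move: h3 h4 e4; rewrite /P /ell !dotpE; lra.
Qed.

(** On [E] the slope [A y] is a subgradient of [H], hence its gradient by uniqueness. *)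
Lemma jet_envelope_extends : extends_jet E f G (fun x => H x - psi x).
Proof.
case: (JC) => -[_ Cpsi] _; have Qpsi := C11loc_quad _ Cpsi.
have [g Qg Hg] := envelope_quad H m (cvx_conv_env m (ell y0) (cvx_ell y0)
  (fun x => ell_le_jet_inf y0 x Ey0)) env_le_jet_inf
  (le_conv_env m) env_coercive jet_inf_semiconcave env_bounded.
have QF := quadD _ _ _ _ Qg (quadN _ _ Qpsi).
split; first exact: quad_C11loc QF.
  by move=> y Ey; rewrite env_on // addrK.
move=> y Ey; have [_ ->] := quad_grad _ _ QF y.
by rewrite (Hg _ _ (env_subgrad y Ey)) addrK.
Qed.

End JetEnvelope.

(** * Convexifying a C11loc function *)

Section FastGrowth.
Context {R : realType}.
Implicit Types (s t u v : R).

Let pos s := Num.max 0 s.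

Let pos_ge0 s : 0 <= pos s. Proof. by rewrite le_max lexx. Qed.

(** The truncated parabola is convex and its Taylor remainder is at most that of the full
    parabola. *)
Let pos_sq_taylor u v :
  0 <= pos v ^+ 2 - pos u ^+ 2 - 2 * pos u * (v - u) <= (v - u) ^+ 2.
Proof.
rewrite /pos; have := sqr_ge0 (v - u); have := sqr_ge0 u; have := sqr_ge0 v.
case: (leP 0 u) => hu; case: (leP 0 v) => hv; rewrite ?expr0n /=.
- by move=> *; apply/andP; split; lra.
- have : 0 <= u * - v by rewrite mulr_ge0 // oppr_ge0 ltW.
  by move=> *; apply/andP; split; lra.
- have : 0 <= v * - u by rewrite mulr_ge0 // oppr_ge0 ltW.
  by move=> *; apply/andP; split; lra.
- by move=> *; apply/andP; split; lra.
Qed.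

(** The cut-off moves with [s]. When each [T k] vanishes up to [k], [locsumE] replaces it by a fixed
    one, valid on a whole half-line. *)
Let locsum (T : nat -> R -> R) s := \sum_(0 <= k < (Num.truncn s).+1) T k s.

Let locsumE (T : nat -> R -> R) s j : (forall k, s <= k%:R -> T k s = 0) ->
  s <= j%:R -> locsum T s = \sum_(0 <= k < j) T k s.
Proof.
move=> T0 sj; rewrite /locsum; have sN := ltW (truncnS_gt s).
have [jN|Nj] := leqP j (Num.truncn s).+1.
  rewrite (@big_cat_nat _ _ _ j) //= [X in _ + X]big_nat [X in _ + X]big1 ?addr0 //.
  by move=> k /andP[jk _]; rewrite T0 // (le_trans sj) // ler_nat.
rewrite [RHS](@big_cat_nat _ _ _ (Num.truncn s).+1) //=; last exact: ltnW.
rewrite [X in _ + X]big_nat [X in _ + X]big1 ?addr0 //.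
by move=> k /andP[jk _]; rewrite T0 // (le_trans sN) // ler_nat.
Qed.

(* th is a locally finite sum of truncated parabolas b_k (s - k)_+^2. *)
Lemma fast_growing_convex (b : nat -> R) : (forall k, 0 <= b k) ->
  exists th dth : R -> R, [/\ forall s, 0 <= dth s,
    forall k s, k.+1%:R <= s -> b k <= dth s &
    forall r, exists2 K, 0 <= K & forall s t, s <= r -> t <= r ->
      0 <= th t - th s - dth s * (t - s) <= K * (t - s) ^+ 2 /\ dth s <= K].
Proof.
move=> b0.
pose T k s := b k * pos (s - k%:R) ^+ 2; pose D k s := 2 * b k * pos (s - k%:R).
have pos0 k s : s <= k%:R -> pos (s - k%:R) = 0.
  by move=> sk; rewrite /pos max_l // subr_le0.
have T0 s k : s <= k%:R -> T k s = 0 by move=> sk; rewrite /T pos0 // expr0n mulr0.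
have D0 s k : s <= k%:R -> D k s = 0 by move=> sk; rewrite /D pos0 // mulr0.
have Dge0 k s : 0 <= D k s by rewrite /D !mulr_ge0.
exists (locsum T), (locsum D); split=> [s|k s ks|r].
- exact: sumr_ge0.
- have kN : (k < (Num.truncn s).+1)%N.
    by rewrite -(ltr_nat R) (lt_trans _ (truncnS_gt s)) // (lt_le_trans _ ks) // ltr_nat.
  rewrite /locsum big_mkord (bigD1 (Ordinal kN)) //= (@le_trans _ _ (D k s)) //.
    (* The [k]-th term alone reaches [b k], since [s] lies at least 1 beyond [k]. *)
    have : 1 <= pos (s - k%:R).
      by rewrite le_max lerBrDl natr1 ks orbT.
    by have := b0 k; rewrite /D; nra.
  by rewrite lerDl sumr_ge0.
- pose j := (Num.truncn r).+1; have rj : r <= j%:R := ltW (truncnS_gt r).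
  pose K1 := \sum_(0 <= k < j) b k; pose K2 := \sum_(0 <= k < j) D k r.
  have K10 : 0 <= K1 by apply: sumr_ge0.
  have K20 : 0 <= K2 by apply: sumr_ge0.
  exists (K1 + K2); first exact: addr_ge0.
  move=> s t sr tr.
  rewrite !(@locsumE _ _ j) ?(le_trans sr) ?(le_trans tr) //; try exact: T0; try exact: D0.
  split; last first.
    rewrite (@le_trans _ _ K2) ?lerDr // /K2; apply: ler_sum => k _.
    rewrite /D ler_wpM2l ?mulr_ge0 // /pos.
    by rewrite ge_max le_max lexx /= le_max lerD2r sr orbT.
  have -> : \sum_(0 <= k < j) T k t - \sum_(0 <= k < j) T k s -
      (\sum_(0 <= k < j) D k s) * (t - s)
      = \sum_(0 <= k < j) (T k t - T k s - D k s * (t - s)).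
    by rewrite mulr_suml -!sumrB.
  have TD k : T k t - T k s - D k s * (t - s) = b k * (pos (t - k%:R) ^+ 2
      - pos (s - k%:R) ^+ 2 - 2 * pos (s - k%:R) * ((t - k%:R) - (s - k%:R))).
    by rewrite /T /D; ring.
  have e k : t - k%:R - (s - k%:R) = t - s by ring.
  apply/andP; split.
    apply: sumr_ge0 => k _; rewrite TD mulr_ge0 //.
    by have /andP[] := pos_sq_taylor (s - k%:R) (t - k%:R).
  rewrite mulrDl (@le_trans _ _ (K1 * (t - s) ^+ 2)) //.
    rewrite mulr_suml; apply: ler_sum => k _; rewrite TD ler_wpM2l //.
    by have /andP[] := pos_sq_taylor (s - k%:R) (t - k%:R); rewrite !e.
  by rewrite lerDl mulr_ge0 // sqr_ge0.
Qed.

End FastGrowth.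

(** * Radial convex functions, local support, and invertible shifts *)

Section Radial.
Context {R : realType} {n : nat}.
Implicit Types (x y : 'rV[R]_n) (F H : 'rV[R]_n -> R) (g : 'rV[R]_n -> 'rV[R]_n).

Lemma dotp_diff x y :
  dotp y y - dotp x x = 2 * dotp x (y - x) + enorm (y - x) ^+ 2.
Proof. by rewrite enorm_sqr !dotpE (dotpC y x); ring. Qed.

(** By [dotp_diff] the remainder of [th (|x|^2)] is that of [th], which is nonnegative, plus
    [dth (|x|^2) * |y - x|^2]. *)
Lemma radial_quad (th dth : R -> R) : (forall s, 0 <= dth s) ->
  (forall r, exists2 K, 0 <= K & forall s t, s <= r -> t <= r ->
      0 <= th t - th s - dth s * (t - s) <= K * (t - s) ^+ 2 /\ dth s <= K) ->
  quad (fun x => th (dotp x x)) (fun x => (2 * dth (dotp x x)) *: x) /\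
  forall x y, dth (dotp x x) * enorm (y - x) ^+ 2 <=
    th (dotp y y) - th (dotp x x) - dotp ((2 * dth (dotp x x)) *: x) (y - x).
Proof.
move=> d0 Hth.
have E x y : th (dotp y y) - th (dotp x x) - dotp ((2 * dth (dotp x x)) *: x) (y - x)
    = th (dotp y y) - th (dotp x x) - dth (dotp x x) * (dotp y y - dotp x x)
      + dth (dotp x x) * enorm (y - x) ^+ 2.
  by rewrite dotp_diff dotpZl; ring.
have lower x y : dth (dotp x x) * enorm (y - x) ^+ 2 <=
    th (dotp y y) - th (dotp x x) - dotp ((2 * dth (dotp x x)) *: x) (y - x).
  have [K K0 HK] := Hth (Num.max (dotp x x) (dotp y y)).
  have [||/andP[h _] _] := HK (dotp x x) (dotp y y); rewrite ?le_max ?lexx ?orbT //.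
  by rewrite E lerDr.
split=> // r; have [r0|r0] := ltP r 0.
  by exists 0 => x y h; have := enorm_ge0 x; lra.
have [K K0 HK] := Hth (r ^+ 2); exists (K * (2 * r) ^+ 2 + K) => x y xr yr.
have sq (z : 'rV[R]_n) : enorm z <= r -> dotp z z <= r ^+ 2.
  by move=> zr; rewrite -enorm_sqr ler_pXn2r ?nnegrE.
have [/andP[h1 h2] h3] := HK _ _ (sq _ xr) (sq _ yr).
have d2 : (dotp y y - dotp x x) ^+ 2 <= (2 * r) ^+ 2 * enorm (y - x) ^+ 2.
  rewrite -exprMn -[leLHS]real_normK ?num_real // ler_pXn2r ?nnegrE ?mulr_ge0 //.
  have -> : dotp y y - dotp x x = dotp (y + x) (y - x) by rewrite !dotpE (dotpC y x); ring.
  rewrite (le_trans (normr_dotp_le _ _)) // ler_wpM2r // (le_trans (enormD_le _ _)) //; lra.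
have h4 := ler_wpM2l K0 d2; have h5 := ler_wpM2r (sqr_ge0 (enorm (y - x))) h3.
have h6 : 0 <= dth (dotp x x) * enorm (y - x) ^+ 2 by rewrite mulr_ge0 ?sqr_ge0.
rewrite E ger0_norm; [lra|exact: addr_ge0].
Qed.

(** Walk from [x] to [y] in equal steps [d] of length at most 1. Adding the local inequalities of a
    step in both directions shows that [dotp (g (p i)) d] is nondecreasing in [i], so each step
    gains at least [dotp (g x) d]. *)
Lemma subgrad_of_local H g :
  (forall x y, enorm (y - x) <= 1 -> H x + dotp (g x) (y - x) <= H y) ->
  forall x, subgrad H x (g x).
Proof.
move=> loc x y; pose N := (Num.truncn (enorm (y - x))).+1.
have N0 : 0 < N%:R :> R by rewrite ltr0n.
pose d := N%:R^-1 *: (y - x).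
have d1 : enorm d <= 1.
  rewrite enormZ ger0_norm ?invr_ge0 ?ler0n // mulrC ler_pdivrMr // mul1r.
  exact/ltW/truncnS_gt.
pose p i : 'rV[R]_n := x + i%:R *: d.
have pS i : p i.+1 - p i = d.
  by rewrite /p opprD addrACA subrr add0r -scalerBl -natr1 addrAC subrr add0r scale1r.
have step i : H x + i%:R * dotp (g x) d <= H (p i) /\
    dotp (g x) d <= dotp (g (p i)) d.
  elim: i => [|i [IH1 IH2]]; first by rewrite /p !scale0r !addr0 mul0r addr0.
  have h1 := loc (p i) (p i.+1); rewrite pS in h1.
  have h2 := loc (p i.+1) (p i); rewrite -opprB pS enormN dotpNr in h2.
  have := h1 d1; have := h2 d1; rewrite -natr1 => k1 k2; split; lra.
have [h _] := step N; have Nd : N%:R *: d = y - x.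
  by rewrite scalerA divff ?scale1r // gt_eqF.
have xy : x + (y - x) = y by rewrite addrC subrK.
by move: h; rewrite -dotpZr /p Nd xy.
Qed.

Lemma cvx_of_subgrad H g : (forall x, subgrad H x (g x)) -> cvx H.
Proof.
move=> sg x y t t0 t1; set z := t *: x + (1 - t) *: y.
have h1 := ler_wpM2l t0 (sg z x).
have t1' : 0 <= 1 - t by lra.
have h2 := ler_wpM2l t1' (sg z y).
have e : t * dotp (g z) (x - z) + (1 - t) * dotp (g z) (y - z) = 0.
  rewrite -!dotpZr -dotpDr (_ : _ + _ = 0) ?dotp0r // !scalerBr addrACA -/z.
  by rewrite -opprD -scalerDl (addrC t) subrK scale1r subrr.
lra.
Qed.

(** As [N + l *: M = - (A - l%:M) *m M], singularity means that [l] is an eigenvalue of [A], which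
    leaves finitely many bad [l]. *)
Lemma exists_shift_unitmx k (M N : 'M[R]_k) (d : R) : M \in unitmx ->
  exists2 l, d <= l & N + l *: M \in unitmx.
Proof.
move=> Mu; pose A := - (N *m invmx M).
(* The size of a polynomial exceeds its degree by one, so these distinct candidates outnumber its
   roots. *)
pose s := [seq `|d| + i%:R | i <- iota 0 (size (char_poly A))].
have [/allP sroot|] := boolP (all (root (char_poly A)) s).
  have : (size s < size (char_poly A))%N.
    apply: max_poly_roots; first by rewrite monic_neq0 // char_poly_monic.
      exact/allP.
    by rewrite map_inj_uniq ?iota_uniq // => i j /addrI/eqP; rewrite eqr_nat => /eqP.
  by rewrite size_map size_iota ltnn.
rewrite -has_predC => /hasP[l /mapP[i _ lE]] /=.
rewrite -eigenvalue_root_char /eigenvalue /eigenspace negbK kermx_eq0 row_free_unit => Au.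
exists l; first by rewrite lE (le_trans (ler_norm d)) // lerDl.
have -> : N + l *: M = - (A - l%:M) *m M.
  by rewrite opprB mulmxDl mul_scalar_mx /A opprK mulmxKV // addrC.
by rewrite unitmx_mul Mu andbT -scaleN1r unitmxZ // unitrN1.
Qed.

(** The coordinates of the standard basis vectors in [X] form a left inverse. *)
Lemma basis_unitmx (X : n.-tuple 'rV[R]_n) : basis_of fullv X ->
  (\matrix_i X`_i : 'M[R]_n) \in unitmx.
Proof.
move=> /andP[/eqP spanX _]; set M := \matrix_i X`_i.
pose B : 'M[R]_n := \matrix_(i, j) coord X j (delta_mx 0 i).
have BM : B *m M = 1%:M.
  apply/row_matrixP => i; rewrite row_mul mulmx_sum_row row1.
  have dX : delta_mx 0 i \in <<X>>%VS by rewrite spanX memvf.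
  rewrite [RHS](coord_span dX); apply: eq_bigr => j _.
  by rewrite rowK !mxE.
by have [] := mulmx1_unit BM.
Qed.

End Radial.

(** * From an extension to the jet conditions *)

Section Necessity.
Context {R : realType} {n : nat}.
Implicit Types (x y z : 'rV[R]_n) (F H : 'rV[R]_n -> R) (g : 'rV[R]_n -> 'rV[R]_n).

Lemma quad_remainder H g y : quad H g ->
  quad (fun x => H x - H y - dotp (g y) (x - y)) (fun x => g x - g y).
Proof.
move=> Q r; have [C HC] := Q r; exists C => x z xr zr.
have := HC x z xr zr; congr (`|_| <= _).
by rewrite !dotpE; ring.
Qed.

(* The coefficient of |y - x|^2 in the convexity of psi beats, near x, the
   constant of the second-order Taylor bound of F. *)
Lemma convexifier F : quad F (grad F) -> exists th dth : R -> R, exists2 b0 : R, 0 <= b0 &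
  forall k : R, b0 <= k ->
  let psi x := th (dotp x x) + k * dotp x x in
  let gpsi x := (2 * (dth (dotp x x) + k)) *: x in
  [/\ quad psi gpsi, forall x, subgrad psi x (gpsi x) &
      forall x, subgrad (fun x => F x + psi x) x (grad F x + gpsi x)].
Proof.
move=> QF.
(* If [j] is the integer part of [|x|^2], then [|x| <= j + 1], and points within 1 of [x] lie in the
   ball of radius [j + 2]. *)
have /choice[b Hb] : forall j : nat, exists C, 0 <= C /\ forall x y,
    enorm x <= j.+2%:R -> enorm y <= j.+2%:R ->
    `|F y - F x - dotp (grad F x) (y - x)| <= C * enorm (y - x) ^+ 2.
  move=> j; have [C HC] := QF j.+2%:R; exists `|C|; split=> // x y xr yr.
  by rewrite (le_trans (HC x y xr yr)) // ler_wpM2r ?sqr_ge0 ?ler_norm.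
(* The shift gives [dth s >= b j] for [s >= j] and [j >= 1]; the case [j = 0] is left to the term
   [k * |x|^2] with [k >= b 0]. *)
have [th [dth [dth0 dthb Hth]]] :=
  fast_growing_convex (fun k => b k.+1) (fun k => (Hb k.+1).1).
exists th, dth, (b 0%N); first exact: (Hb 0%N).1.
move=> k bk psi gpsi; have k0 : 0 <= k := le_trans (Hb 0%N).1 bk.
have [||Qpsi low] := @radial_quad R n (fun s => th s + k * s) (fun s => dth s + k).
- by move=> s; rewrite addr_ge0.
- move=> r; have [K K0 HK] := Hth r; exists (K + k); first exact: addr_ge0.
  move=> s t sr tr; have [/andP[h1 h2] h3] := HK s t sr tr.
  have e : th t + k * t - (th s + k * s) - (dth s + k) * (t - s)
      = th t - th s - dth s * (t - s) by ring.
  rewrite e h1 lerD2r h3; split=> //=; rewrite (le_trans h2) //.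
  by rewrite ler_wpM2r ?sqr_ge0 // lerDl.
have sub x y : 0 <= (dth (dotp x x) + k) * enorm (y - x) ^+ 2.
  by rewrite mulr_ge0 ?sqr_ge0 // addr_ge0.
split=> // [x y|].
  by have := low x y; have := sub x y; rewrite /psi /gpsi; lra.
apply: (@subgrad_of_local _ _ (fun x => F x + psi x) (fun x => grad F x + gpsi x)).
move=> x y yx; pose j := Num.truncn (dotp x x).
have sj : dotp x x < j.+1%:R by exact: truncnS_gt.
have j1 : 1 <= j.+1%:R :> R by rewrite ler1n.
have xj : enorm x <= j.+1%:R.
  rewrite leNgt; apply/negP => h; move: sj; rewrite -enorm_sqr ltNge => /negP; apply.
  nra.
have bj : b j <= dth (dotp x x) + k.
  have [j0|j0] := posnP j; first by rewrite j0 (le_trans bk) // lerDr.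
  have := dthb j.-1 (dotp x x); rewrite prednK // truncn_le dotp_ge0.
  by move=> /(_ isT)/le_trans; apply; rewrite lerDl.
have jj : j.+2%:R = j.+1%:R + 1 :> R by rewrite natr1.
have xj2 : enorm x <= j.+2%:R by rewrite jj; lra.
have yj2 : enorm y <= j.+2%:R.
  by rewrite jj (le_trans (enorm_leD y x)) // lerD.
have := (Hb j).2 x y xj2 yj2; rewrite ler_norml => /andP[h1 _].
have h2 := low x y; have h3 := ler_wpM2r (sqr_ge0 (enorm (y - x))) bj.
by rewrite dotpDl /psi /gpsi; lra.
Qed.

Lemma lin_span_unitmx (S : set 'rV[R]_n) (D : 'M[R]_n) :
  D \in unitmx -> (forall i, S (row i D)) -> lin_span S = setT.
Proof.
move=> Du SD; apply/seteqP; split=> // v _.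
exists n, (fun i => (v *m invmx D) 0 i), (fun i => row i D); split=> //.
by rewrite -mulmx_sum_row mulmxKV.
Qed.

Lemma extension_jet_conditions (E : set 'rV[R]_n) (f : 'rV[R]_n -> R) G F
    (p : 'I_n.+1 -> 'rV[R]_n) :
  (forall i, E (p i)) ->
  basis_of (fullv : {vspace 'rV[R]_n})
    [seq p (lift ord0 i) - p ord0 | i <- enum 'I_n] ->
  extends_jet E f G F -> exists psi phi, jet_conditions E f G psi phi.
Proof.
move=> Ep Bp [CF fE GE]; have QF := C11loc_quad _ CF.
have [th [dth [b0 b00 conv]]] := convexifier F QF.
pose X := [tuple p (lift ord0 i) - p ord0 | i < n].
pose M : 'M[R]_n := \matrix_i X`_i.
have Mu : M \in unitmx by exact: basis_unitmx.
(* [q] is the part of the gradient of [F + psi] independent of [l]: the full gradient is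
   [q x + l *: x], so its differences at the affine basis are the rows of [N + l *: M]. *)
pose q x := grad F x + (2 * dth (dotp x x)) *: x.
pose N : 'M[R]_n := \matrix_i (q (p (lift ord0 i)) - q (p ord0)).
have [l bl Nu] := exists_shift_unitmx n M N (2 * b0) Mu.
have [|Qpsi spsi sH] := conv (l / 2); first by rewrite ler_pdivlMr // mulrC.
set psi := fun x => th (dotp x x) + l / 2 * dotp x x in Qpsi spsi sH *.
set gpsi := fun x => (2 * (dth (dotp x x) + l / 2)) *: x in Qpsi spsi sH *.
have QH := quadD _ _ _ _ QF Qpsi.
set H := fun x => F x + psi x in QH sH *.
set gH := fun x => grad F x + gpsi x in QH sH *.
have gradpsi x : grad psi x = gpsi x by have [] := quad_grad _ _ Qpsi x.
have gHE y : E y -> G y + grad psi y = gH y by move=> Ey; rewrite -GE // gradpsi.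
have HE y : E y -> f y + psi y = H y by move=> Ey; rewrite -fE.
pose phi y x := H x - H y - dotp (gH y) (x - y).
have Qphi y : quad (phi y) (fun x => gH x - gH y) by exact: quad_remainder.
have gradphi y x : grad (phi y) x = gH x - gH y.
  by have [] := quad_grad _ _ (Qphi y) x.
exists psi, phi; split; last split; last split; last split; last split.
- split; last exact: quad_C11loc Qpsi.
  by apply/convex_functionP; exact: cvx_of_subgrad spsi.
- move=> y Ey; split; first exact: quad_C11loc (Qphi y).
  by move=> x; rewrite /phi; have := sH y x; lra.
- apply: (lin_span_unitmx _ _ Nu) => i.
  exists (p (lift ord0 i)); first exact: Ep.
  exists (p ord0); first exact: Ep.
  rewrite -[_ - G (p ord0) - _]addrA -opprD !gHE //.
  have -> : row i (N + l *: M) = row i N + l *: row i M.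
    by apply/rowP => j; rewrite !mxE.
  rewrite !rowK nth_mktuple.
  have gHq x : gH x = q x + l *: x.
    rewrite /gH /gpsi /q -addrA -scalerDl; congr (_ + _ *: _).
    by field.
  by rewrite !gHq scalerBr opprD addrACA.
- move=> y Ey; rewrite gradphi subrr; split=> //.
  by rewrite /phi !subrr dotp0r subrr.
(* Differences of [grad (phi y)] are those of [gH] and do not depend on [y], so one Lipschitz
   constant serves all [y]. *)
- move=> r r0; have [L L0 HL] := quad_lipschitz _ _ r QH.
  apply: (@le_lt_trans _ _ L%:E); last exact: ltry.
  apply: ge_ereal_sup => _ [x [z [y [xr zr xz _ ->]]]].
  rewrite /eball /= !subr0 in xr zr.
  rewrite lee_fin ler_pdivrMr.
    rewrite !gradphi opprB addrA subrK; exact: HL.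
  rewrite lt_neqAle enorm_ge0 andbT eq_sym.
  by apply: contra xz => /eqP/enorm_eq0/eqP; rewrite subr_eq0.
- move=> y z x Ey Ez; rewrite !HE // !gHE //.
  by have := sH z x; rewrite /phi /subgrad; lra.
Qed.

End Necessity.

Theorem theorem4p7 (R : realType) (n : nat) (E : set 'rV[R]_n)
  (hE : exists p : 'I_n.+1 -> 'rV[R]_n,
     (forall i, E (p i)) /\
     basis_of (fullv : {vspace 'rV[R]_n})
       [seq p (lift ord0 i) - p ord0 | i <- enum 'I_n])
  (f : 'rV[R]_n -> R) (G : 'rV[R]_n -> 'rV[R]_n) :
  ((exists F : 'rV[R]_n -> R, extends_jet E f G F) <->
   (exists (psi : 'rV[R]_n -> R) (phi : 'rV[R]_n -> 'rV[R]_n -> R),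
      jet_conditions E f G psi phi)) /\
  (forall (psi : 'rV[R]_n -> R) (phi : 'rV[R]_n -> 'rV[R]_n -> R),
     jet_conditions E f G psi phi ->
     forall a : R, 0 < a ->
       extends_jet E f G
         (fun x => conv_env (jet_inf E f G psi phi a) x - psi x)).
Proof.
have [p [Ep Bp]] := hE.
have env psi phi : jet_conditions E f G psi phi -> forall a : R, 0 < a ->
    extends_jet E f G (fun x => conv_env (jet_inf E f G psi phi a) x - psi x).
  by move=> JC a a0; exact: jet_envelope_extends JC a0 (p ord0) (Ep ord0).
split=> //; split=> [[F]|[psi [phi JC]]]; first exact: extension_jet_conditions.
by eexists; exact: env JC 1 ltr01.
Qed.
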